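(* Suppose that $\mathcal X$ is convex and let $t>0$. The problem $$\begin{aligned}\min\ &\alpha+\beta\Omega-\kappa\big(1-2e^{-(t/K_{\mathrm{sw}})^\vartheta}\big)+\frac1M\sum_{m\in[M]}\nu_m\big(\mathbb E_{\hat{\mathbb P}_N}[\ell(z_m,\xi)]+\epsilon\big)\\ \text{s.t. }&x\in\mathcal X,\ \alpha\in\mathbb R,\ \beta,\kappa\in\mathbb R_+,\ \nu\in\mathbb R_+^M,\\ &\ell(x,\xi)+\kappa\,\mathbb I_{\{\|\xi\|\le t\}}\le\alpha+\beta\|\xi\|^2+\frac1M\sum_{m\in[M]}\nu_m\ell(z_m,\xi)\qquad\forall\xi\in\mathbb R^{D_\xi}\end{aligned}$$ is equivalent to the finite convex conic program $$\begin{aligned}\min\ &\alpha+\beta\Omega-\kappa\big(1-2e^{-(t/K_{\mathrm{sw}})^\vartheta}\big)+\frac1M\sum_{m\in[M]}\nu_m\big(\mathbb E_{\hat{\mathbb P}_N}[\ell(z_m,\xi)]+\epsilon\big)\\ \text{s.t. }&x\in\mathcal X,\ \alpha\in\mathbb R,\ \beta,\kappa\in\mathbb R_+,\ \nu\in\mathbb R_+^M,\\ &\lambda_{jm},\lambda'_{jm}\in\mathbb R_+^J\ \ \forall j\in[J],\ \forall m\in[M],\qquad\theta_j\in\mathbb R^{D_\xi},\ \zeta_j,\zeta'_j\in\mathbb R_+\ \ \forall j\in[J],\\ &\mathbf e^\top\lambda_{jm}=\nu_m,\quad\mathbf e^\top\lambda'_{jm}=\nu_m\quad\forall m\in[M],\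 \forall j\in[J],\\ &\zeta_j+b_j(x)-\frac1M\sum_{m\in[M],k\in[J]}\lambda_{jm}^kb_k(z_m)\le\alpha\quad\forall j\in[J],\\ &\left\|\begin{bmatrix}a_j(x)-\frac1M\sum_{m\in[M],k\in[J]}\lambda_{jm}^ka_k(z_m)\\ \zeta_j-\beta\end{bmatrix}\right\|\le\zeta_j+\beta\quad\forall j\in[J],\\ &\zeta'_j+t\|\theta_j\|+b_j(x)+\kappa-\frac1M\sum_{m\in[M],k\in[J]}\lambda_{jm}'^{k}b_k(z_m)\le\alpha\quad\forall j\in[J],\\ &\left\|\begin{bmatrix}a_j(x)-\frac1M\sum_{m\in[M],k\in[J]}\lambda_{jm}'^{k}a_k(z_m)-\theta_j\\ \zeta'_j-\beta\end{bmatrix}\right\|\le\zeta'_j+\beta\quad\forall j\in[J].\end{aligned}$$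
   Context: $\mathcal X\subseteq\mathbb R^{D_x}$ is compact. The uncertainty support is $\Xi=\mathbb R^{D_\xi}$. The loss is $\ell(x,\xi)=\max_{j\in[J]}\big(a_j(x)^\top\xi+b_j(x)\big)$ with $a_j(x)=\mathbf A_jx+\bar{\mathbf a}_j\in\mathbb R^{D_\xi}$ and $b_j(x)=\mathbf b_j^\top x+\bar b_j$ affine in $x$. $K_{\mathrm{sw}},\vartheta>0$ are constants; $\hat{\mathbb P}_N$ is a reference (empirical) distribution on $\mathbb R^{D_\xi}$ with $\mathbb E_{\hat{\mathbb P}_N}[\|\xi\|^2]<\Omega$; $\epsilon\ge0$; $z_1,\dots,z_M\in\mathcal X$ are given sampled points. $\mathbb I_{\{\cdot\}}$ is the indicator, $\mathbf e$ is the all-ones vector, $\lambda^k_{jm}$ (resp. $\lambda'^k_{jm}$) is the $k$-th component, and $\|\cdot\|$ is the Euclidean norm. ''Equivalent'' means that $(x,\alpha,\beta,\kappa,\nu)$ is feasible in the first problem if and only if it can be completed by the auxiliary variables to a feasible point of the second (the objectives being identical). *)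

(* Defs.v *)
From HB Require Import structures.
From mathcomp Require Import all_boot all_order all_algebra.
From mathcomp Require Import all_classical all_reals all_analysis.

Set Implicit Arguments.
Unset Strict Implicit.
Unset Printing Implicit Defensive.

Import Order.TTheory GRing.Theory Num.Theory.
Import numFieldNormedType.Exports.

Local Open Scope classical_set_scope.
Local Open Scope ring_scope.

Definition dot {R : realType} {n : nat} (u v : 'cV[R]_n) : R :=
  \sum_(i < n) u i 0 * v i 0.

(* Euclidean norm; the library's norm on matrices is the sup norm. *)
Definition enorm {R : realType} {n : nat} (u : 'cV[R]_n) : R :=
  Num.sqrt (dot u u).

(* R^n with its Borel sigma-algebra. *)
Definition borel_cV (R : realType) (n : nat) :=
  g_sigma_algebraType (@open 'cV[R]_n).

Record program (R : realType) (V : lmodType R) := Program {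
  objective : V -> R;
  feasible : set V }.

Definition convex_program (R : realType) (V : lmodType R) (P : program V) :=
  @convex_set R V (feasible P) /\
  @convex_function R V (feasible P) (objective P).

(* Feasibility in [P] is feasibility in [Q] of some completion by auxiliary
   variables, which do not enter the objective. *)
Definition equivalent (R : realType) (V W : lmodType R)
    (P : program V) (Q : program (V * W)%type) :=
  (forall v, feasible P v <-> exists w, feasible Q (v, w)) /\
  (forall v w, objective Q (v, w) = objective P v).

(* A piecewise affine loss with J.+1 pieces, so that the maximum below ranges
   over a nonempty index set. *)
Record pwa_loss (R : realType) (Dx D J : nat) := PwaLoss {
  lA : 'I_J.+1 -> 'M[R]_(D, Dx);
  labar : 'I_J.+1 -> 'cV[R]_D;
  lb : 'I_J.+1 -> 'cV[R]_Dx;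
  lbbar : 'I_J.+1 -> R }.

Section Programs.
Context {R : realType} {Dx D J : nat}.
Variable L : pwa_loss R Dx D J.

Definition slope (j : 'I_J.+1) (x : 'cV[R]_Dx) : 'cV[R]_D :=
  lA L j *m x + labar L j.

Definition offset (j : 'I_J.+1) (x : 'cV[R]_Dx) : R :=
  dot (lb L j) x + lbbar L j.

Definition loss (x : 'cV[R]_Dx) (xi : 'cV[R]_D) : R :=
  let piece j := dot (slope j x) xi + offset j x in
  \big[Num.max/piece ord0]_(j < J.+1) piece j.

Context {M : nat}.
Variables (X : set 'cV[R]_Dx) (z : 'I_M -> 'cV[R]_Dx) (t : R).

(* (x, alpha, beta, kappa, nu) *)
Definition mainvar : lmodType R :=
  ('cV[R]_Dx * R^o * R^o * R^o * 'cV[R]_M)%type.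

(* (lambda, lambda', theta, zeta, zeta') *)
Definition auxvar : lmodType R :=
  (('I_J.+1 -> 'I_M -> 'cV[R]_J.+1) * ('I_J.+1 -> 'I_M -> 'cV[R]_J.+1) *
   ('I_J.+1 -> 'cV[R]_D) * ('I_J.+1 -> R^o) * ('I_J.+1 -> R^o))%type.

Definition basic_constraints (v : mainvar) : Prop :=
  let: (x, alpha, beta, kappa, nu) := v in
  [/\ X x, 0 <= beta, 0 <= kappa & forall m, 0 <= nu m 0].

Definition semi_infinite_constraint (v : mainvar) : Prop :=
  let: (x, alpha, beta, kappa, nu) := v in
  forall xi : 'cV[R]_D,
    loss x xi + kappa * \1_[set u : 'cV[R]_D | enorm u <= t] xi
    <= alpha + beta * enorm xi ^+ 2
       + M%:R^-1 * \sum_(m < M) nu m 0 * loss (z m) xi.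

Definition avg_slope (la : 'I_M -> 'cV[R]_J.+1) : 'cV[R]_D :=
  M%:R^-1 *: \sum_(m < M) \sum_(k < J.+1) la m k 0 *: slope k (z m).

Definition avg_offset (la : 'I_M -> 'cV[R]_J.+1) : R :=
  M%:R^-1 * \sum_(m < M) \sum_(k < J.+1) la m k 0 * offset k (z m).

Definition conic_constraints (v : mainvar) (w : auxvar) : Prop :=
  let: (x, alpha, beta, kappa, nu) := v in
  let: (la, la', theta, zeta, zeta') := w in
  [/\ (forall j m k, 0 <= la j m k 0) /\ (forall j m k, 0 <= la' j m k 0),
      (forall j, 0 <= zeta j) /\ (forall j, 0 <= zeta' j),
      (forall m j, \sum_(k < J.+1) la j m k 0 = nu m 0) /\
      (forall m j, \sum_(k < J.+1) la' j m k 0 = nu m 0),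
      (forall j, zeta j + offset j x - avg_offset (la j) <= alpha) /\
      (forall j,
         enorm (col_mx (slope j x - avg_slope (la j))
                       (const_mx (zeta j - beta) : 'cV[R]_1))
         <= zeta j + beta)
    & (forall j,
         zeta' j + t * enorm (theta j) + offset j x + kappa
           - avg_offset (la' j) <= alpha) /\
      (forall j,
         enorm (col_mx (slope j x - avg_slope (la' j) - theta j)
                       (const_mx (zeta' j - beta) : 'cV[R]_1))
         <= zeta' j + beta)].

Variables (P : probability (borel_cV R D) R) (Omega eps Ksw vartheta : R).

(* The expectations are finite once [P] has a finite second moment. *)
Definition cost (v : mainvar) : R :=
  let: (x, alpha, beta, kappa, nu) := v in
  alpha + beta * Omega
  - kappa * (1 - 2 * expR (- ((t / Ksw) `^ vartheta)))
  + M%:R^-1 *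
    \sum_(m < M) nu m 0 * (fine ('E_P[loss (z m)])%E + eps).

Definition semi_infinite_program : program mainvar :=
  Program cost [set v | basic_constraints v /\ semi_infinite_constraint v].

Definition conic_program : program (mainvar * auxvar)%type :=
  Program (fun p => cost p.1)
    [set p | basic_constraints p.1 /\ conic_constraints p.1 p.2].

End Programs.

(* Main.v *)
Require Import Defs.
From HB Require Import structures.
From mathcomp Require Import all_boot all_order all_algebra.
From mathcomp Require Import all_classical all_reals all_analysis.
From mathcomp Require Import ring lra.

Set Implicit Arguments.
Unset Strict Implicit.
Unset Printing Implicit Defensive.

Import Order.TTheory GRing.Theory Num.Theory.
Import numFieldNormedType.Exports.

Local Open Scope classical_set_scope.
Local Open Scope ring_scope.

(** Each of the [J.+1] pieces of the loss contributes two inequalities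
    [dot a xi + b <= alpha + beta |xi|^2 + (1/M) sum_m nu_m loss(z_m, xi)]:
    one over the whole space and, since the indicator contributes [kappa] only
    inside the ball and [kappa >= 0], one with [b + kappa] over the ball of
    radius [t].  Both are turned into cone constraints by the same two steps.

    First the maxima inside the losses on the right are removed.  The right-hand
    side is the maximum, over the choices [s] of a piece for each sample [z_m],
    of convex quadratic functions of [xi].  If a maximum of finitely many convex
    functions is nonnegative on a convex set, then so is some fixed convex
    combination of them ([convexlike_alternative]).  This plays the role of a
    minimax theorem, but the case of two functions is merely a comparison of
    lower and upper bounds on the real line, and the general case follows by
    induction.  The marginals, for each [m], of the weights on the choices [s],
    multiplied by [nu_m], are the vectors [lambda_{jm}] ([multipliers_exist]).
    Conversely, any such [lambda] yields a lower bound of the averaged losses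
    ([avg_piece_le]).

    What remains is a single inequality [dot d xi <= c + beta |xi|^2].  Over the
    whole space it says that the discriminant of a parabola is nonpositive
    ([dot_le_quadraticP]), which is a rotated second-order cone constraint
    ([rotated_cone]).  Over a ball the minimizer of the right-hand side minus
    the left-hand side lies either inside the ball, where [theta = 0] works, or
    on its boundary, where [theta] is the part of [d] in excess of the gradient
    of [beta |xi|^2] ([ball_dot_le_quadraticP]).

    The conic program is convex because the sample points [z_m] are constants:
    slopes, offsets and their averages are then affine in all the variables
    jointly, and the Euclidean norm is convex. *)

(** * Euclidean norm *)

Section Euclidean.
Context {R : realType} {n : nat}.
Implicit Types (u v w : 'cV[R]_n) (a : R).

Lemma dotC u v : dot u v = dot v u.
Proof. by apply: eq_bigr => i _; rewrite mulrC. Qed.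

Lemma dotDl u v w : dot (u + v) w = dot u w + dot v w.
Proof.
by rewrite -big_split; apply: eq_bigr => i _; rewrite mxE mulrDl.
Qed.

Lemma dotZl a u v : dot (a *: u) v = a * dot u v.
Proof. by rewrite mulr_sumr; apply: eq_bigr => i _; rewrite mxE mulrA. Qed.

Lemma dotNl u v : dot (- u) v = - dot u v.
Proof. by rewrite -scaleN1r dotZl mulN1r. Qed.

Lemma dot0l v : dot 0 v = 0.
Proof. by rewrite -[0](scale0r 0) dotZl mul0r. Qed.

Lemma dotDr u v w : dot u (v + w) = dot u v + dot u w.
Proof. by rewrite dotC dotDl !(dotC u). Qed.

Lemma dotZr a u v : dot u (a *: v) = a * dot u v.
Proof. by rewrite dotC dotZl dotC. Qed.

Lemma dotNr u v : dot u (- v) = - dot u v.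
Proof. by rewrite dotC dotNl dotC. Qed.

Lemma dot0r u : dot u 0 = 0.
Proof. by rewrite dotC dot0l. Qed.

Lemma dot_suml (I : Type) (s : seq I) (F : I -> 'cV[R]_n) v :
  dot (\sum_(i <- s) F i) v = \sum_(i <- s) dot (F i) v.
Proof.
elim: s => [|i s IHs]; first by rewrite !big_nil dot0l.
by rewrite !big_cons dotDl IHs.
Qed.

Definition dotE := (dotDl, dotDr, dotZl, dotZr, dotNl, dotNr).

Lemma dot_ge0 u : 0 <= dot u u.
Proof. by apply: sumr_ge0 => i _; rewrite -expr2 sqr_ge0. Qed.

(** Cauchy-Schwarz: the quadratic polynomial [a |-> |u + a v|^2] is
    nonnegative, in particular at its vertex. *)
Lemma dot_sqr_le u v : dot u v ^+ 2 <= dot u u * dot v v.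
Proof.
have line a : 0 <= dot u u + 2 * a * dot u v + a ^+ 2 * dot v v.
  have := dot_ge0 (u + a *: v); rewrite !dotE (dotC v u).
  by rewrite (_ : _ + _ = dot u u + 2 * a * dot u v + a ^+ 2 * dot v v) //; ring.
have uu := dot_ge0 u; have vv := dot_ge0 v.
have [v0|v0] := eqVneq (dot v v) 0.
  (* A degenerate parabola is an affine function, bounded below only if its
     slope vanishes. *)
  have [->|uv0] := eqVneq (dot u v) 0; first by rewrite expr0n mulr_ge0.
  have := line (- (dot u u + 1) / (2 * dot u v)).
  rewrite v0 mulr0 addr0 (_ : 2 * _ * _ = - (dot u u + 1)); last by field.
  lra.
have := line (- dot u v / dot v v).
rewrite (_ : _ + _ = dot u u - dot u v ^+ 2 / dot v v); last by field.
by rewrite subr_ge0 ler_pdivrMr // lt_def v0.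
Qed.

Lemma enorm_ge0 u : 0 <= enorm u.
Proof. exact: sqrtr_ge0. Qed.

Lemma enorm_sqr u : enorm u ^+ 2 = dot u u.
Proof. by rewrite sqr_sqrtr // dot_ge0. Qed.

Lemma enorm_leE u a : 0 <= a -> (enorm u <= a) = (dot u u <= a ^+ 2).
Proof. by move=> a0; rewrite -enorm_sqr ler_sqr ?nnegrE ?enorm_ge0. Qed.

Lemma dot_le_enorm u v : dot u v <= enorm u * enorm v.
Proof.
apply: le_trans (ler_norm _) _.
rewrite -ler_sqr ?nnegrE ?mulr_ge0 ?enorm_ge0 //.
by rewrite real_normK ?num_real // exprMn !enorm_sqr dot_sqr_le.
Qed.

Lemma enormZ a u : 0 <= a -> enorm (a *: u) = a * enorm u.
Proof.
by move=> a0; rewrite /enorm !dotE mulrA -expr2 sqrtrM ?sqr_ge0 // sqrtr_sqr ger0_norm.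
Qed.

Lemma enormD u v : enorm (u + v) <= enorm u + enorm v.
Proof.
have u0 := enorm_ge0 u; have v0 := enorm_ge0 v.
rewrite enorm_leE ?addr_ge0 // !dotE (dotC v u) -!enorm_sqr.
have := dot_le_enorm u v; nra.
Qed.

Lemma enorm0 : enorm (0 : 'cV[R]_n) = 0.
Proof. by rewrite /enorm dot0l sqrtr0. Qed.

Lemma enorm_conv (p q : R) u v : 0 <= p -> 0 <= q ->
  enorm (p *: u + q *: v) <= p * enorm u + q * enorm v.
Proof. by move=> p0 q0; rewrite -!enormZ // enormD. Qed.

Lemma enorm_sqr_conv (p : R) u v : 0 <= p <= 1 ->
  enorm (p *: u + (1 - p) *: v) ^+ 2 <= p * enorm u ^+ 2 + (1 - p) * enorm v ^+ 2.
Proof.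
move=> /andP[p0 p1]; rewrite !enorm_sqr.
have pq0 : 0 <= p * (1 - p) by rewrite mulr_ge0 ?subr_ge0.
have := mulr_ge0 pq0 (dot_ge0 (u - v)); rewrite !dotE (dotC v u); lra.
Qed.

End Euclidean.

(** Squaring turns the rotated second-order cone into a bound on
    a product, which is the discriminant condition of a parabola. *)
Lemma rotated_cone (R : realType) (n : nat) (u : 'cV[R]_n) (zeta beta : R) :
  0 <= zeta -> 0 <= beta ->
  (enorm (col_mx u (const_mx (zeta - beta) : 'cV[R]_1)) <= zeta + beta)
  = (dot u u <= 4 * beta * zeta).
Proof.
move=> z0 b0; rewrite enorm_leE ?addr_ge0 // {1}/dot big_split_ord /= big_ord1.
under eq_bigr do rewrite !col_mxEu.
rewrite !col_mxEd !mxE -/(dot u u).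
by apply/idP/idP; nra.
Qed.

(** * A theorem of the alternative for convex functions *)

Section Alternative.
Context {R : realType} {T : Type}.
Implicit Types C : set T.

(** Convexity of the family [f] on [C] in the weak form due to Ky Fan: the
    point [w] need not be the convex combination of [x] and [y], but it must
    serve all members of the family at once.  The type [T] then needs no linear
    structure, and replacing members of the family by their convex combinations
    or maxima preserves the property. *)
Definition convexlike (I : Type) C (f : I -> T -> R) :=
  forall (x y : T) (p : R), C x -> C y -> 0 <= p <= 1 ->
  exists2 w, C w & forall i, f i w <= p * f i x + (1 - p) * f i y.

(** Where [f] is negative, the condition on [s] is the upper bound
    [s <= g / (g - f)]; where [g] is negative, it is the lower bound
    [- g / (f - g) <= s]; elsewhere every [s] in [[0, 1]] will do.  Convexity makes each
    lower bound at most each upper bound, and the supremum of the lower bounds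
    is a solution. *)
Lemma convexlike_alternative2 C (f g : T -> R) :
  convexlike C (fun b : bool => if b then f else g) ->
  (forall x, C x -> 0 <= f x \/ 0 <= g x) ->
  exists2 s, 0 <= s <= 1 & forall x, C x -> 0 <= s * f x + (1 - s) * g x.
Proof.
move=> Cfg fg0.
(* This is the comparison of the two bounds, cleared of denominators.  If it
   failed, the weights below would make both functions negative at once. *)
have cross x y : C x -> C y -> f x < 0 -> g y < 0 -> g y * f x <= f y * g x.
  move=> Cx Cy fx gy; rewrite leNgt; apply/negP => lt.
  have gx : 0 <= g x by case: (fg0 x Cx) => //; lra.
  have fy : 0 <= f y by case: (fg0 y Cy) => //; lra.
  pose r := f y - g y; pose e := g x - f x.
  have er : 0 < e + r by rewrite /e /r; lra.
  have p01 : 0 <= r / (e + r) <= 1.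
    by rewrite divr_ge0 ?ler_pdivrMr ?mul1r /r /e //=; lra.
  have [w Cw fgw] := Cfg x y _ Cx Cy p01.
  have E : 1 - r / (e + r) = e / (e + r) by field; lra.
  have fw : f w < 0.
    apply: le_lt_trans (fgw true) _; rewrite E.
    rewrite ![_ / _ * _]mulrAC -mulrDl pmulr_llt0 ?invr_gt0 // /r /e; nra.
  have gw : g w < 0.
    apply: le_lt_trans (fgw false) _; rewrite E.
    rewrite ![_ / _ * _]mulrAC -mulrDl pmulr_llt0 ?invr_gt0 // /r /e; nra.
  by case: (fg0 w Cw); lra.
pose S : set R :=
  [set s | s = 0 \/ exists y, [/\ C y, g y < 0 & s = - g y / (f y - g y)]].
have S0 : S 0 by left.
have S_ub x : C x -> f x < 0 -> ubound S (g x / (g x - f x)).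
  move=> Cx fx s Ss.
  have gx : 0 <= g x by case: (fg0 x Cx) => //; lra.
  have {Ss} [->|[y [Cy gy ->]]] := Ss; first by apply: divr_ge0; lra.
  have fy : 0 <= f y by case: (fg0 y Cy) => //; lra.
  rewrite ler_pdivrMr ?subr_gt0; last lra.
  rewrite mulrAC ler_pdivlMr ?subr_gt0; last lra.
  have := cross x y Cx Cy fx gy; nra.
have S1 : ubound S 1.
  move=> s [->|[y [Cy gy ->]]]; first exact: ler01.
  have fy : 0 <= f y by case: (fg0 y Cy) => //; lra.
  by rewrite ler_pdivrMr; lra.
have ubS : has_ubound S by exists 1.
have s0 : 0 <= sup S by apply: (ub_le_sup ubS).
have s1 : sup S <= 1 by apply: ge_sup => //; exists 0.
exists (sup S); first by rewrite s0.
move=> x Cx; have [fx|fx] := ltP (f x) 0.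
  have gx : 0 <= g x by case: (fg0 x Cx) => //; lra.
  have : sup S <= g x / (g x - f x) by apply: ge_sup; [exists 0 | exact: S_ub].
  by rewrite ler_pdivlMr; lra.
have [gx|gx] := ltP (g x) 0; last by nra.
have : - g x / (f x - g x) <= sup S.
  by apply: (ub_le_sup ubS); right; exists x.
by rewrite ler_pdivrMr; lra.
Qed.

(** Induction on the number of functions: the case of two functions, applied to
    one member [f i0] and the maximum of the others, gives a weight [p] for
    which the maximum of the functions [p * f i0 + (1 - p) * f i] is
    nonnegative, and there is one function less in this family. *)
Lemma convexlike_alternative (I : finType) C (f : I -> T -> R) :
  (0 < #|I|)%N -> convexlike C f ->
  (forall x, C x -> exists i, 0 <= f i x) ->
  exists mu : I -> R,
    [/\ forall i, 0 <= mu i, \sum_i mu i = 1 &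
        forall x, C x -> 0 <= \sum_i mu i * f i x].
Proof.
move=> /card_gt0P[j0 _] fC f_ge0.
suff H s (i0 : I) : forall f : I -> T -> R, convexlike C f ->
    (forall x, C x -> exists2 i, i \in i0 :: s & 0 <= f i x) ->
    exists mu : I -> R, [/\ forall i, 0 <= mu i, \sum_i mu i = 1 &
      forall x, C x -> 0 <= \sum_i mu i * f i x].
  apply: (H (enum I) j0 f fC) => x /f_ge0[i fi].
  by exists i; rewrite // inE mem_enum orbT.
(* The list [i0 :: s] bounds the members that enter the maximum; the weights
   stay indexed by the whole of [I]. *)
move=> {fC f_ge0 j0}; elim: s i0 {f} => [|i1 s IHs] i0 f Cf f0.
  exists (fun i => (i == i0)%:R); split.
  - by move=> i; rewrite ler0n.
  - by rewrite (bigD1 i0) //= eqxx big1 ?addr0 // => i /negPf->.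
  - move=> x Cx; have [i] := f0 x Cx; rewrite inE => /eqP-> fx.
    by rewrite (bigD1 i0) //= eqxx mul1r big1 ?addr0 // => j /negPf->; rewrite mul0r.
pose g x := \big[Num.max/f i1 x]_(i <- s) f i x.
have gP x : exists2 i, i \in i1 :: s & g x = f i x.
  rewrite /g; elim: (s) => [|i s' [j js' e]]; first by exists i1; rewrite ?big_nil ?inE.
  rewrite big_cons; have [le|lt] := leP (f i x) (\big[Num.max/f i1 x]_(i <- s') f i x).
    by exists j => //; move: js'; rewrite !inE => /orP[->|->]; rewrite ?orbT.
  by exists i; rewrite ?inE ?eqxx ?orbT.
have g_ge i x : i \in i1 :: s -> f i x <= g x.
  rewrite inE => /predU1P[->|si]; first exact: bigmax_ge_id.
  exact: le_bigmax_seq.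
have [s01 | | p /andP[p0 p1] pP] := @convexlike_alternative2 C (f i0) g.
- move=> y q Cx Cy /[dup] q01 /andP[q0 q1].
  have [w Cw fw] := Cf _ _ q Cx Cy q01; exists w => // -[]; first exact: fw.
  have [i si ->] := gP w; apply: le_trans (fw i) _.
  by rewrite lerD // ler_wpM2l ?subr_ge0 ?g_ge.
- move=> x /f0[i]; rewrite inE => /predU1P[->|si fi]; first by left.
  by right; apply: le_trans fi (g_ge _ _ si).
have [||mu [mu0 mu1 muP]] := IHs i1 (fun i x => p * f i0 x + (1 - p) * f i x).
- move=> x y q Cx Cy q01; have [w Cw fw] := Cf _ _ q Cx Cy q01.
  exists w => // i.
  have := ler_wpM2l p0 (fw i0).
  have : 0 <= 1 - p by rewrite subr_ge0.
  by move=> /ler_wpM2l /(_ _ _ (fw i)); lra.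
- by move=> x /pP; have [i si ->] := gP x; exists i.
exists (fun i => p * (i == i0)%:R + (1 - p) * mu i); split.
- by move=> i; rewrite addr_ge0 ?mulr_ge0 ?ler0n ?subr_ge0.
- rewrite big_split /= -!mulr_sumr mu1 (bigD1 i0) //= eqxx big1 ?addr0 => [|i /negPf-> //].
  by rewrite !mulr1 addrC subrK.
- move=> x /muP; under eq_bigr do rewrite mulrDr mulrA [_ * p]mulrC mulrCA mulrA.
  rewrite big_split /= -mulr_suml -mulr_sumr mu1 mulr1.
  under [in X in _ -> X]eq_bigr do rewrite mulrDl -mulrA.
  rewrite big_split /= (_ : \sum_i p * _ = p * f i0 x) //.
  rewrite -mulr_sumr (bigD1 i0) //= eqxx mul1r big1 ?addr0 // => i /negPf->.
  by rewrite mul0r.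
Qed.

End Alternative.

(** * Linear forms below a quadratic *)

Section Quadratic.
Context {R : realType} {n : nat}.
Implicit Types (d th xi : 'cV[R]_n) (b c ze t : R).

(** By Cauchy-Schwarz [(dot d xi)^2 <= 4 b ze |xi|^2], and this is at most
    [(ze + b |xi|^2)^2] by the arithmetic-geometric mean inequality. *)
Lemma dot_le_quadratic d b ze xi : 0 <= b -> 0 <= ze ->
  dot d d <= 4 * b * ze -> dot d xi <= ze + b * enorm xi ^+ 2.
Proof.
move=> b0 z0 dd; rewrite enorm_sqr.
have q0 := dot_ge0 xi; have cs := dot_sqr_le d xi.
have w0 : 0 <= ze + b * dot xi xi by rewrite addr_ge0 ?mulr_ge0.
apply: le_trans (ler_norm _) _.
rewrite -ler_sqr ?nnegrE // real_normK ?num_real //.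
apply: le_trans cs _; apply: le_trans (ler_wpM2r q0 dd) _.
by have := sqr_ge0 (ze - b * dot xi xi); lra.
Qed.

(** A single test point decides the discriminant: the minimizer [d / (2 b)] of
    [b |xi|^2 - dot d xi], to be checked only when [b > 0]. *)
Lemma quadratic_discriminant d b c : 0 <= b -> 0 <= c ->
  (b = 0 -> d = 0) ->
  (0 < b -> dot d ((2 * b)^-1 *: d) <= c + b * enorm ((2 * b)^-1 *: d) ^+ 2) ->
  dot d d <= 4 * b * c.
Proof.
rewrite le_eqVlt => /predU1P[<- _ /(_ erefl)-> _|b0 c0 _ /(_ b0)].
  by rewrite dot0l mulr0 mul0r.
rewrite enorm_sqr !dotE -subr_ge0.
rewrite (_ : _ - _ = (4 * b * c - dot d d) / (4 * b)); last by field; lra.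
by rewrite pmulr_lge0 ?subr_ge0 // invr_gt0; lra.
Qed.

Lemma dot_self_eq0 d : dot d d = 0 -> d = 0.
Proof.
move=> /eqP; rewrite psumr_eq0 => [/allP d0|i _]; last by rewrite -expr2 sqr_ge0.
apply/colP => i; have := d0 i; rewrite mem_index_enum mulf_eq0 orbb mxE.
by move=> /(_ isT)/eqP.
Qed.

(** Nonpositive discriminant of a quadratic function on the whole space.  When
    [b = 0] the right-hand side is constant, and [d] must vanish since a nonzero
    linear form is unbounded. *)
Lemma dot_le_quadraticP d b c : 0 <= b ->
  (forall xi, dot d xi <= c + b * enorm xi ^+ 2) <->
  0 <= c /\ dot d d <= 4 * b * c.
Proof.
move=> b0; split=> [H|[c0 dd] xi]; last exact: dot_le_quadratic.
have c0 : 0 <= c by have := H 0; rewrite dot0r enorm0 expr0n mulr0 addr0.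
split=> //; apply: quadratic_discriminant => // bE; apply: dot_self_eq0; apply/eqP.
(* This multiple of [d] gives the linear form the value [c + 1]. *)
apply/contraT => d0; have := H (((c + 1) / dot d d) *: d).
by rewrite bE mul0r addr0 !dotE divfK //; lra.
Qed.

(** The vector [th] is absorbed by the ball, at the price of [t |th|], and
    [d - th] by the quadratic.  If [|d| <= 2 b t], the function
    [b |xi|^2 - dot d xi] attains its global minimum in the ball, and [th = 0]
    will do.  Otherwise its minimum over the ball is at [xi = t d / |d|], and
    [d - th] is the gradient [2 b xi] of the quadratic at that point. *)
Lemma ball_dot_le_quadraticP d b c t : 0 < t -> 0 <= b ->
  (forall xi, enorm xi <= t -> dot d xi <= c + b * enorm xi ^+ 2) <->
  exists th ze, [/\ 0 <= ze, ze + t * enorm th <= c &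
                    dot (d - th) (d - th) <= 4 * b * ze].
Proof.
move=> t0 b0; split=> [H|[th [ze [ze0 zec dd]]] xi xit]; last first.
  have := dot_le_quadratic xi b0 ze0 dd; have := dot_le_enorm th xi.
  have := ler_wpM2l (enorm_ge0 th) xit; rewrite !dotE; lra.
have c0 : 0 <= c.
  by have := H 0; rewrite dot0r enorm0 expr0n mulr0 addr0; apply; exact: ltW.
have [small|large] := leP (enorm d) (2 * b * t).
  exists 0, c; rewrite enorm0 mulr0 addr0 subr0; split=> //.
  apply: quadratic_discriminant => // [bE|bpos].
    apply: dot_self_eq0; apply/eqP; rewrite eq_le dot_ge0 andbT.
    have := enorm_leE d (lexx 0); rewrite expr0n => <-.
    by move: small; rewrite bE mulr0 mul0r.
  apply: H; rewrite enormZ ?invr_ge0 ?mulr_ge0 //.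
  by rewrite mulrC ler_pdivrMr ?mulr_gt0 // mulrC.
have n0 : 0 < enorm d by apply: le_lt_trans large; rewrite !mulr_ge0 // ltW.
pose r := 2 * b * t / enorm d.
have r0 : 0 <= r by rewrite !mulr_ge0 ?invr_ge0 ?enorm_ge0 // ltW.
have r1 : r <= 1 by rewrite ler_pdivrMr // mul1r ltW.
exists ((1 - r) *: d), (b * t ^+ 2); split.
- by rewrite mulr_ge0 ?sqr_ge0.
- rewrite enormZ ?subr_ge0 // mulrBl mul1r divfK ?gt_eqF //.
  have e : enorm ((t / enorm d) *: d) = t.
    by rewrite enormZ ?divfK ?gt_eqF ?divr_ge0 ?ltW.
  have := H ((t / enorm d) *: d); rewrite e lexx => /(_ isT).
  rewrite dotZr -enorm_sqr expr2 mulrA divfK ?gt_eqF //; lra.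
- rewrite scalerBl scale1r opprB addrC subrK !dotE -enorm_sqr.
  rewrite (_ : r * (r * _) = (r * enorm d) ^+ 2); last by ring.
  by rewrite divfK ?gt_eqF //; lra.
Qed.

End Quadratic.

(** * Multipliers for the piecewise affine losses *)

Section Loss.
Context {R : realType} {Dx D J M : nat}.
Variables (L : pwa_loss R Dx D J) (z : 'I_M -> 'cV[R]_Dx).
Implicit Types (x : 'cV[R]_Dx) (xi : 'cV[R]_D) (nu : 'cV[R]_M).
Implicit Types (la : 'I_M -> 'cV[R]_J.+1).

Definition piece j x xi : R := dot (slope L j x) xi + offset L j x.

Lemma piece_le_loss j x xi : piece j x xi <= loss L x xi.
Proof. exact: (le_bigmax _ (fun j => piece j x xi)). Qed.

Lemma loss_attained x xi : exists j, loss L x xi = piece j x xi.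
Proof.
rewrite /loss -/(piece ord0 x xi).
elim/big_ind: _ => [|u v [i ->] [j ->]|j _]; first by exists ord0.
  by rewrite maxEle; case: ifP => _; [exists j | exists i].
by exists j.
Qed.

Lemma avg_pieceE la xi :
  dot (avg_slope L z la) xi + avg_offset L z la =
  M%:R^-1 * \sum_(m < M) \sum_(k < J.+1) la m k 0 * piece k (z m) xi.
Proof.
rewrite /avg_slope /avg_offset dotZl -mulrDr dot_suml -big_split /=.
congr (_ * _); apply: eq_bigr => m _; rewrite dot_suml -big_split /=.
by apply: eq_bigr => k _; rewrite dotZl -mulrDr.
Qed.

Definition multipliers nu la :=
  (forall m k, 0 <= la m k 0) /\ (forall m, \sum_(k < J.+1) la m k 0 = nu m 0).

(** Weak duality: nonnegative weights of sum [nu m] on the pieces give at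
    most [nu m] times their maximum. *)
Lemma avg_piece_le nu la xi : multipliers nu la ->
  dot (avg_slope L z la) xi + avg_offset L z la
  <= M%:R^-1 * \sum_(m < M) nu m 0 * loss L (z m) xi.
Proof.
move=> [la0 la1]; rewrite avg_pieceE ler_wpM2l ?invr_ge0 ?ler0n //.
apply: ler_sum => m _; rewrite -la1 mulr_suml; apply: ler_sum => k _.
by rewrite ler_wpM2l ?piece_le_loss.
Qed.

(** Strong duality.  The functions [f s], indexed by the choices [s] of one
    piece for each sample, are convex, and their maximum is the right-hand side
    minus the left-hand side of the hypothesis.  The alternative yields weights
    [mu s]; as each sum over [m] involves [s] only through [s m], only the
    marginals of [mu] matter, and these are the multipliers. *)
Lemma multipliers_exist (C : set 'cV[R]_D) (al be : R) (a : 'cV[R]_D) (b : R) nu :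
  (forall u v (p : R), C u -> C v -> 0 <= p <= 1 -> C (p *: u + (1 - p) *: v)) ->
  0 <= be -> (forall m, 0 <= nu m 0) ->
  (forall xi, C xi -> dot a xi + b <= al + be * enorm xi ^+ 2
     + M%:R^-1 * \sum_(m < M) nu m 0 * loss L (z m) xi) ->
  exists2 la, multipliers nu la & forall xi, C xi ->
    dot (a - avg_slope L z la) xi
    <= al - b + avg_offset L z la + be * enorm xi ^+ 2.
Proof.
move=> Cconv be0 nu0 H.
pose f (s : {ffun 'I_M -> 'I_J.+1}) xi : R :=
  al - b + be * enorm xi ^+ 2 - dot a xi
  + M%:R^-1 * \sum_(m < M) nu m 0 * piece (s m) (z m) xi.
have [|||mu [mu0 mu1 muP]] := @convexlike_alternative R _ _ C f.
- by apply/card_gt0P; exists [ffun=> ord0].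
- move=> x y p Cx Cy p01; exists (p *: x + (1 - p) *: y); first exact: Cconv.
  move=> s; have := ler_wpM2l be0 (enorm_sqr_conv x y p01).
  have E : \sum_(m < M) nu m 0 * piece (s m) (z m) (p *: x + (1 - p) *: y)
      = p * (\sum_(m < M) nu m 0 * piece (s m) (z m) x)
        + (1 - p) * (\sum_(m < M) nu m 0 * piece (s m) (z m) y).
    rewrite !mulr_sumr -big_split /=; apply: eq_bigr => m _.
    by rewrite /piece !dotE; ring.
  by rewrite /f E !dotE; lra.
- move=> xi Cxi.
  (* Choose for each sample a piece that attains the maximum at [xi]. *)
  exists [ffun m => sval (cid (loss_attained (z m) xi))].
  rewrite /f; under eq_bigr do rewrite ffunE -(svalP (cid (loss_attained _ _))).
  by have := H xi Cxi; lra.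
pose la m : 'cV[R]_J.+1 :=
  \col_k (nu m 0 * \sum_(s : {ffun 'I_M -> 'I_J.+1} | s m == k) mu s).
have sum_fibre (m : 'I_M) (F : 'I_J.+1 -> R) :
    \sum_k la m k 0 * F k = nu m 0 * \sum_(s : {ffun 'I_M -> 'I_J.+1}) mu s * F (s m).
  rewrite (partition_big (fun s : {ffun 'I_M -> 'I_J.+1} => s m) xpredT) //=.
  rewrite mulr_sumr; apply: eq_bigr => k _; rewrite mxE -mulrA mulr_suml.
  by congr (_ * _); apply: eq_bigr => s /eqP->.
exists la; [split=> m|].
- by move=> k; rewrite mxE mulr_ge0 // sumr_ge0.
- have := sum_fibre m (fun=> 1); under eq_bigr do rewrite mulr1.
  by move=> ->; under eq_bigr do rewrite mulr1; rewrite mu1 mulr1.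
- move=> xi /muP; rewrite /f.
  under eq_bigr do rewrite mulrDr (mulrCA _ M%:R^-1).
  rewrite big_split /= -mulr_suml mu1 mul1r -mulr_sumr.
  have -> : \sum_(s : {ffun 'I_M -> 'I_J.+1})
        mu s * (\sum_(m < M) nu m 0 * piece (s m) (z m) xi)
      = \sum_(m < M) \sum_k la m k 0 * piece k (z m) xi.
    under [RHS]eq_bigr do rewrite sum_fibre mulr_sumr.
    rewrite exchange_big /=; apply: eq_bigr => s _; rewrite mulr_sumr.
    by apply: eq_bigr => m _; rewrite mulrCA.
  by rewrite -avg_pieceE dotDl dotNl; lra.
Qed.

End Loss.

(** * Equivalence of the two constraint systems *)

Section Equivalence.
Context {R : realType} {Dx D J M : nat}.
Variables (L : pwa_loss R Dx D J) (z : 'I_M -> 'cV[R]_Dx).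
Implicit Types (a th xi : 'cV[R]_D) (la : 'I_M -> 'cV[R]_J.+1).
Variables (al be : R) (nu : 'cV[R]_M).
Hypotheses (be_ge0 : 0 <= be) (nu_ge0 : forall m, 0 <= nu m 0).

Let bound xi :=
  al + be * enorm xi ^+ 2 + M%:R^-1 * \sum_(m < M) nu m 0 * loss L (z m) xi.

Lemma affine_le_bound_conicP a (b : R) :
  (forall xi, dot a xi + b <= bound xi) <->
  exists la ze, [/\ multipliers nu la, 0 <= ze,
    ze + b - avg_offset L z la <= al &
    enorm (col_mx (a - avg_slope L z la) (const_mx (ze - be) : 'cV[R]_1))
      <= ze + be].
Proof.
split=> [H|[la [ze [la_nu ze0 ze_al cone]]] xi].
  have [//||la la_nu laP] :=
    @multipliers_exist _ _ _ _ _ L z setT al be a b nu _ be_ge0 nu_ge0.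
    by move=> xi _; exact: H.
  have /(dot_le_quadraticP _ _ be_ge0)[c0 dd] := fun xi => laP xi I.
  exists la, (al - b + avg_offset L z la); split=> //; first lra.
  by rewrite rotated_cone.
move: cone; rewrite rotated_cone // => /(dot_le_quadratic xi be_ge0 ze0).
have := avg_piece_le L z xi la_nu; rewrite dotDl dotNl /bound; lra.
Qed.

Lemma affine_le_bound_ball_conicP a (b t : R) : 0 < t ->
  (forall xi, enorm xi <= t -> dot a xi + b <= bound xi) <->
  exists la th ze, [/\ multipliers nu la, 0 <= ze,
    ze + t * enorm th + b - avg_offset L z la <= al &
    enorm (col_mx (a - avg_slope L z la - th) (const_mx (ze - be) : 'cV[R]_1))
      <= ze + be].
Proof.
move=> t0; split=> [H|[la [th [ze [la_nu ze0 ze_al cone]]]] xi xit].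
  have [||la la_nu laP] :=
    @multipliers_exist _ _ _ _ _ L z [set xi | enorm xi <= t] al be a b nu
       _ be_ge0 nu_ge0.
  - move=> u v p /= ut vt /andP[p0 p1].
    have q0 : 0 <= 1 - p by rewrite subr_ge0.
    apply: le_trans (enorm_conv u v p0 q0) _.
    have := ler_wpM2l p0 ut; have := ler_wpM2l q0 vt; lra.
  - by move=> xi; exact: H.
  have /(ball_dot_le_quadraticP _ _ t0 be_ge0) := laP.
  move=> [th [ze [ze0 zec dd]]]; exists la, th, ze; split=> //; first lra.
  by rewrite rotated_cone.
have /(ball_dot_le_quadraticP _ _ t0 be_ge0) : exists th' ze',
    [/\ 0 <= ze', ze' + t * enorm th' <= ze + t * enorm th &
        dot (a - avg_slope L z la - th') (a - avg_slope L z la - th')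
        <= 4 * be * ze'].
  by exists th, ze; split=> //; rewrite -rotated_cone.
move=> /(_ xi xit).
have := avg_piece_le L z xi la_nu; rewrite dotDl dotNl /bound; lra.
Qed.

End Equivalence.

Section Programs.
Context {R : realType} {Dx D J M : nat}.
Variables (L : pwa_loss R Dx D J) (X : set 'cV[R]_Dx) (z : 'I_M -> 'cV[R]_Dx).
Variables (t : R).

(** The indicator only matters inside the ball, and there the inequality with
    [ka] implies the one without it because [ka >= 0]; so the latter may be
    imposed everywhere. *)
Lemma semi_infinite_splitP x (al be ka : R) (nu : 'cV[R]_M) : 0 <= ka ->
  semi_infinite_constraint L z t (x, al, be, ka, nu) <->
  forall j,
    (forall xi, dot (slope L j x) xi + offset L j x
       <= al + be * enorm xi ^+ 2
          + M%:R^-1 * \sum_(m < M) nu m 0 * loss L (z m) xi) /\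
    (forall xi, enorm xi <= t -> dot (slope L j x) xi + (offset L j x + ka)
       <= al + be * enorm xi ^+ 2
          + M%:R^-1 * \sum_(m < M) nu m 0 * loss L (z m) xi).
Proof.
move=> ka0; split=> [H j|H xi].
  split=> xi => [|xit].
    apply: le_trans (H xi); apply: le_trans (piece_le_loss L j x xi) _.
    by rewrite lerDl mulr_ge0.
  apply: le_trans (H xi); rewrite indicE mem_set // mulr1 addrA lerD2r.
  exact: piece_le_loss.
have [j ->] := loss_attained L x xi; have [H1 H2] := H j.
rewrite indicE; have [xit|xit] := leP (enorm xi) t.
  by rewrite mem_set // mulr1 -addrA; exact: H2.
rewrite memNset ?mulr0 ?addr0; first exact: H1.
by rewrite /= leNgt xit.
Qed.

Lemma conic_constraintsP (v : @mainvar R Dx M) : 0 < t -> basic_constraints X v ->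
  semi_infinite_constraint L z t v <-> exists w, conic_constraints L z t v w.
Proof.
move: v => [[[[x al] be] ka] nu] t0 [_ be0 ka0 nu0].
rewrite semi_infinite_splitP //; split=> [H|].
  have [la /choice[ze P1]] :=
    choice (fun j => (affine_le_bound_conicP L z al be0 nu0 _ _).1 (H j).1).
  have [la' /choice[th /choice[ze' P2]]] :=
    choice (fun j =>
      (affine_le_bound_ball_conicP L z al be0 nu0 _ _ t0).1 (H j).2).
  exists (la, la', th, ze, ze'); split.
  - by split=> j; [have [[]] := P1 j | have [[]] := P2 j].
  - by split=> j; [have [] := P1 j | have [] := P2 j].
  - by split=> m j; [have [[]] := P1 j | have [[]] := P2 j].
  - by split=> j; have [] := P1 j.
  - by split=> j; have [_ _ + ?] := P2 j; rewrite // addrA.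
move=> [[[[[la la'] th] ze] ze'] [[la0 la'0] [ze0 ze'0] [la1 la'1] [c1 s1] [c2 s2]]] j.
split.
  apply/(affine_le_bound_conicP L z al be0 nu0).
  by exists (la j), (ze j); split=> //.
apply/(affine_le_bound_ball_conicP L z al be0 nu0 _ _ t0).
by exists (la' j), (th j), (ze' j); split=> //; rewrite addrA.
Qed.

End Programs.

(** * Convexity of the conic program *)

Section CoordinateCombinations.
Context {R : realType}.

(** These equations hold by definition, but products nest deeply in the type of
    the variables of the programs.  Rewriting one level at a time spares the
    type checker from comparing the module structures of all the factors. *)
Lemma comb_pair (U V : lmodType R) (p q : R) (u u' : U) (v v' : V) :
  p *: (u, v) + q *: (u', v') = (p *: u + q *: u', p *: v + q *: v').
Proof. by []. Qed.

Lemma conv_pair (U V : lmodType R) (l : {i01 R}) (u u' : U) (v v' : V) :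
  conv l ((u, v) : convex_lmodType (U * V)%type) (u', v')
  = (l%:num *: u + (1 - l%:num) *: u', l%:num *: v + (1 - l%:num) *: v').
Proof. exact: comb_pair. Qed.

End CoordinateCombinations.

Section Convexity.
Context {R : realType} {Dx D J M : nat}.
Variables (L : pwa_loss R Dx D J) (z : 'I_M -> 'cV[R]_Dx).

Lemma slope_conv j x y (p : R) :
  slope L j (p *: x + (1 - p) *: y) = p *: slope L j x + (1 - p) *: slope L j y.
Proof.
rewrite /slope mulmxDr -!scalemxAr !scalerDr !scalerBl !scale1r.
by apply/colP => i; rewrite !mxE; ring.
Qed.

Lemma offset_conv j x y (p : R) :
  offset L j (p *: x + (1 - p) *: y) = p * offset L j x + (1 - p) * offset L j y.
Proof. by rewrite /offset !dotE; ring. Qed.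

Lemma avg_slope_lin (p q : R) (la la' : 'I_M -> 'cV[R]_J.+1) :
  avg_slope L z (fun m => p *: la m + q *: la' m)
  = p *: avg_slope L z la + q *: avg_slope L z la'.
Proof.
rewrite /avg_slope !scalerA ![_ * M%:R^-1]mulrC -!scalerA -scalerDr; congr (_ *: _).
rewrite !scaler_sumr -big_split /=; apply: eq_bigr => m _.
rewrite !scaler_sumr -big_split /=; apply: eq_bigr => k _.
by rewrite !mxE scalerDl !scalerA.
Qed.

Lemma avg_offset_lin (p q : R) (la la' : 'I_M -> 'cV[R]_J.+1) :
  avg_offset L z (fun m => p *: la m + q *: la' m)
  = p * avg_offset L z la + q * avg_offset L z la'.
Proof.
rewrite /avg_offset !(mulrCA _ M%:R^-1) -mulrDr; congr (_ * _).
rewrite !mulr_sumr -big_split /=; apply: eq_bigr => m _.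
rewrite !mulr_sumr -big_split /=; apply: eq_bigr => k _.
by rewrite !mxE; ring.
Qed.

Lemma cone_conv (p be be' ze ze' : R) (u u' : 'cV[R]_D) : 0 <= p <= 1 ->
  enorm (col_mx u (const_mx (ze - be) : 'cV[R]_1)) <= ze + be ->
  enorm (col_mx u' (const_mx (ze' - be') : 'cV[R]_1)) <= ze' + be' ->
  enorm (col_mx (p *: u + (1 - p) *: u')
    (const_mx (p * ze + (1 - p) * ze' - (p * be + (1 - p) * be')) : 'cV[R]_1))
  <= p * ze + (1 - p) * ze' + (p * be + (1 - p) * be').
Proof.
move=> /andP[p0 p1] h h'.
have q0 : 0 <= 1 - p by rewrite subr_ge0.
have -> : const_mx (p * ze + (1 - p) * ze' - (p * be + (1 - p) * be')) =
    p *: const_mx (ze - be) + (1 - p) *: const_mx (ze' - be') :> 'cV[R]_1.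
  by apply/colP => i; rewrite !mxE; ring.
rewrite -add_col_mx -!scale_col_mx; apply: le_trans (enorm_conv _ _ p0 q0) _.
have := ler_wpM2l p0 h; have := ler_wpM2l q0 h'; lra.
Qed.


(** Every constraint is affine in the variables jointly, except for the norms of
    affine functions of them, which occur on the smaller side of inequalities,
    the norm of [th] with the nonnegative factor [t]. *)
Lemma conic_constraints_conv (t p : R) (x1 x2 : 'cV[R]_Dx)
    (al1 al2 be1 be2 ka1 ka2 : R) (nu1 nu2 : 'cV[R]_M)
    (la1 la2 la1' la2' : 'I_J.+1 -> 'I_M -> 'cV[R]_J.+1)
    (th1 th2 : 'I_J.+1 -> 'cV[R]_D) (ze1 ze2 ze1' ze2' : 'I_J.+1 -> R) :
  0 <= t -> 0 <= p <= 1 ->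
  conic_constraints L z t (x1, al1, be1, ka1, nu1) (la1, la1', th1, ze1, ze1') ->
  conic_constraints L z t (x2, al2, be2, ka2, nu2) (la2, la2', th2, ze2, ze2') ->
  conic_constraints L z t
    (p *: x1 + (1 - p) *: x2, p * al1 + (1 - p) * al2, p * be1 + (1 - p) * be2,
     p * ka1 + (1 - p) * ka2, p *: nu1 + (1 - p) *: nu2)
    (fun j m => p *: la1 j m + (1 - p) *: la2 j m,
     fun j m => p *: la1' j m + (1 - p) *: la2' j m,
     fun j => p *: th1 j + (1 - p) *: th2 j,
     fun j => p * ze1 j + (1 - p) * ze2 j,
     fun j => p * ze1' j + (1 - p) * ze2' j).
Proof.
move=> t0 /[dup] p01 /andP[p0 p1].
have q0 : 0 <= 1 - p by rewrite subr_ge0.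
move=> [[la1_ge0 la1'_ge0] [ze1_ge0 ze1'_ge0] [la1_sum la1'_sum]
  [lin1 soc1] [lin1' soc1']].
move=> [[la2_ge0 la2'_ge0] [ze2_ge0 ze2'_ge0] [la2_sum la2'_sum]
  [lin2 soc2] [lin2' soc2']].
split.
- by split=> j m k; rewrite !mxE addr_ge0 ?mulr_ge0.
- by split=> j; rewrite addr_ge0 ?mulr_ge0.
- split=> m j; under eq_bigr do rewrite !mxE;
    rewrite big_split -!mulr_sumr ?la1_sum ?la2_sum ?la1'_sum ?la2'_sum; 
    by rewrite !mxE.
- split=> j.
    rewrite offset_conv avg_offset_lin.
    have := ler_wpM2l p0 (lin1 j); have := ler_wpM2l q0 (lin2 j); lra.
  apply: le_trans (cone_conv p01 (soc1 j) (soc2 j)); rewrite slope_conv avg_slope_lin.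
  rewrite le_eqVlt; apply/predU1P; left; congr (enorm (col_mx _ _)).
  by rewrite !scalerBr opprD addrACA.
- split=> j.
    rewrite offset_conv avg_offset_lin.
    have := ler_wpM2l t0 (enorm_conv (th1 j) (th2 j) p0 q0).
    have := ler_wpM2l p0 (lin1' j); have := ler_wpM2l q0 (lin2' j); lra.
  apply: le_trans (cone_conv p01 (soc1' j) (soc2' j)); rewrite slope_conv avg_slope_lin.
  rewrite le_eqVlt; apply/predU1P; left; congr (enorm (col_mx _ _)).
  by rewrite !scalerBr !opprD [X in X + _ = _]addrACA [LHS]addrACA. 
Qed.

Lemma mainvar_comb (p q : R) (x1 x2 : 'cV[R]_Dx)
    (al1 al2 be1 be2 ka1 ka2 : R) (nu1 nu2 : 'cV[R]_M) :
  p *: ((x1, al1, be1, ka1, nu1) : @mainvar R Dx M)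
   + q *: ((x2, al2, be2, ka2, nu2) : @mainvar R Dx M) =
    (p *: x1 + q *: x2, p * al1 + q * al2, p * be1 + q * be2,
     p * ka1 + q * ka2, p *: nu1 + q *: nu2).
Proof. by rewrite !comb_pair. Qed.

Lemma auxvar_comb (p q : R)
    (la1 la2 la1' la2' : 'I_J.+1 -> 'I_M -> 'cV[R]_J.+1)
    (th1 th2 : 'I_J.+1 -> 'cV[R]_D) (ze1 ze2 ze1' ze2' : 'I_J.+1 -> R) :
  p *: ((la1, la1', th1, ze1, ze1') : @auxvar R D J M)
   + q *: ((la2, la2', th2, ze2, ze2') : @auxvar R D J M) =
    (fun j m => p *: la1 j m + q *: la2 j m,
     fun j m => p *: la1' j m + q *: la2' j m,
     fun j => p *: th1 j + q *: th2 j,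
     fun j => p * ze1 j + q * ze2 j,
     fun j => p * ze1' j + q * ze2' j).
Proof. by rewrite !comb_pair. Qed.

Lemma conic_feasible_convex (X : set 'cV[R]_Dx) (t : R)
    (P : probability (borel_cV R D) R) (Omega eps Ksw vartheta : R) :
  0 <= t -> @convex_set R 'cV[R]_Dx X ->
  @convex_set R _ (feasible (conic_program L X z t P Omega eps Ksw vartheta)).
Proof.
move=> t0 Xconv.
move=> [[[[[x1 al1] be1] ka1] nu1] [[[[la1 la1'] th1] ze1] ze1']].
move=> [[[[[x2 al2] be2] ka2] nu2] [[[[la2 la2'] th2] ze2] ze2']] l.
rewrite conv_pair mainvar_comb auxvar_comb !inE => -[[Xx1 be1_ge0 ka1_ge0 nu1_ge0] conic1].
move=> [[Xx2 be2_ge0 ka2_ge0 nu2_ge0] conic2].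
have p01 : 0 <= l%:num <= 1 by rewrite ge0 le1.
have /andP[p0 p1] := p01.
have q0 : 0 <= 1 - l%:num by rewrite subr_ge0.
split; last exact: (conic_constraints_conv t0 p01 conic1 conic2).
split.
- by have := Xconv x1 x2 l; rewrite !inE; apply.
- exact: (addr_ge0 (mulr_ge0 p0 be1_ge0) (mulr_ge0 q0 be2_ge0)).
- exact: (addr_ge0 (mulr_ge0 p0 ka1_ge0) (mulr_ge0 q0 ka2_ge0)).
- move=> m; rewrite !mxE.
  exact: (addr_ge0 (mulr_ge0 p0 (nu1_ge0 m)) (mulr_ge0 q0 (nu2_ge0 m))).
Qed.

Lemma cost_conv (P : probability (borel_cV R D) R) (Omega eps Ksw vartheta : R)
    (t p : R) (x1 x2 : 'cV[R]_Dx) (al1 al2 be1 be2 ka1 ka2 : R)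
    (nu1 nu2 : 'cV[R]_M) :
  cost L z t P Omega eps Ksw vartheta
    (p *: x1 + (1 - p) *: x2, p * al1 + (1 - p) * al2, p * be1 + (1 - p) * be2,
     p * ka1 + (1 - p) * ka2, p *: nu1 + (1 - p) *: nu2)
  = p * cost L z t P Omega eps Ksw vartheta (x1, al1, be1, ka1, nu1)
    + (1 - p) * cost L z t P Omega eps Ksw vartheta (x2, al2, be2, ka2, nu2).
Proof.
rewrite /cost.
set c := fun m => fine ('E_P[loss L (z m)])%E + eps.
set e := 1 - 2 * _.
have -> : \sum_(m < M) (p *: nu1 + (1 - p) *: nu2) m 0 * c m
    = p * (\sum_(m < M) nu1 m 0 * c m) + (1 - p) * (\sum_(m < M) nu2 m 0 * c m).
  rewrite !mulr_sumr -big_split /=; apply: eq_bigr => m _.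
  by rewrite !mxE mulrDl !mulrA.
by ring.
Qed.

Lemma conic_objective_convex (X : set 'cV[R]_Dx) (t : R)
    (P : probability (borel_cV R D) R) (Omega eps Ksw vartheta : R) :
  @convex_function R _ (feasible (conic_program L X z t P Omega eps Ksw vartheta))
    (objective (conic_program L X z t P Omega eps Ksw vartheta)).
Proof.
move=> l.
move=> [[[[[x1 al1] be1] ka1] nu1] w1] [[[[[x2 al2] be2] ka2] nu2] w2] _ _.
rewrite conv_pair mainvar_comb convRE.
have := cost_conv P Omega eps Ksw vartheta t l%:num x1 x2 al1 al2 be1 be2
  ka1 ka2 nu1 nu2.
by move=> E; rewrite /objective /conic_program E.
Qed.

End Convexity.

Theorem theorem8 (R : realType) (Dx D J M : nat) (L : pwa_loss R Dx D J)
    (X : set 'cV[R]_Dx) (z : 'I_M -> 'cV[R]_Dx)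
    (P : probability (borel_cV R D) R)
    (Omega eps Ksw vartheta t : R)
    (hM : (0 < M)%N)
    (X_compact : compact X)
    (X_convex : @convex_set R 'cV[R]_Dx X)
    (z_in_X : forall m, X (z m))
    (P_moment : ('E_P[fun xi : borel_cV R D => (enorm xi ^+ 2)%R] < Omega%:E)%E)
    (eps_ge0 : 0 <= eps)
    (Ksw_gt0 : 0 < Ksw)
    (vartheta_gt0 : 0 < vartheta)
    (t_gt0 : 0 < t) :
  equivalent (semi_infinite_program L X z t P Omega eps Ksw vartheta)
             (conic_program L X z t P Omega eps Ksw vartheta) /\
  convex_program (conic_program L X z t P Omega eps Ksw vartheta).
Proof.
split; last first.
  by split; [apply: conic_feasible_convex => //; exact: ltW
            | exact: conic_objective_convex].
split=> [v|v w] //; split=> [[basic semi]|[w [basic conic]]].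
  have [w conic] := (conic_constraintsP L z t_gt0 basic).1 semi.
  by exists w.
by split=> //; apply/(conic_constraintsP L z t_gt0 basic); exists w.
Qed.
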